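(* Let $k\ge 5$ and let $T_1,\dots,T_k$ be trees on a common vertex set $V$ with $|V|=n$, having no common leaves (no vertex is a leaf in two different trees). Let $w\in V$ be an arbitrary vertex. If $n\ge 4k-2$, then there is a rainbow matching in the first $k-1$ trees avoiding $w$: that is, there are pairwise vertex-disjoint edges $e_1,\dots,e_{k-1}$, none incident to $w$, with $e_i$ an edge of $T_i$ for each $i$.
   Context: Each $T_i$ is a tree spanning all of $V$. A rainbow matching in an edge-colored graph is a set of pairwise vertex-disjoint edges no two of which have the same color; here the color of an edge is the tree it belongs to. *)

(* Defs.v *)
From mathcomp Require Import all_boot.

Set Implicit Arguments.
Unset Strict Implicit.
Unset Printing Implicit Defensive.

Section Graphs.
Variable V : finType.
Implicit Types e : rel V.

Definition simple_graph e := symmetric e /\ irreflexive e.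

Definition connected_graph e := forall x y : V, connect e x y.

(* [ucycle e [:: x; y]] holds as soon as x and y are adjacent and distinct, so
   genuine cycles of a simple graph are those with at least 3 vertices. *)
Definition acyclic_graph e := forall c : seq V, ucycle e c -> size c < 3.

(* A tree whose vertex set is the whole type V. *)
Definition tree e :=
  [/\ simple_graph e, connected_graph e & acyclic_graph e].

Definition degree e (v : V) : nat := #|[set u | e v u]|.

Definition leaf e (v : V) : bool := degree e v == 1.

(* Edges are unordered pairs, represented as two-element sets. *)
Definition edges e : {set {set V}} := [set [set x; y] | x in V, y in V & e x y].

End Graphs.

(* Main.v *)
Require Import Defs.
From mathcomp Require Import all_boot.
From mathcomp Require Import zify.

Set Implicit Arguments.
Unset Strict Implicit.
Unset Printing Implicit Defensive.

(** A vertex cover [X] of a tree on [n] vertices with [l] leaves satisfies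
    [n + 1 <= 2|X| + l]: the complement of [X] is independent, so its degrees
    add up to at most the number [n - 1] of edges, while each of its vertices
    has degree at least 2 unless it is a leaf.  Now choose the edges greedily,
    treating the trees in decreasing order of their numbers of leaves.  Among
    the first [s] trees the last one has at most [(n - 2) / s] leaves, since the
    leaf sets are disjoint and [T_k] has two leaves of its own.  Hence [w]
    together with the [2 (s - 1)] vertices used before it do not cover it. *)

Lemma card_set_sum (U : finType) (P : pred U) : #|[set u | P u]| = \sum_u P u.
Proof.
rewrite cardsE -sum1_card big_mkcond; apply: eq_bigr => u _.
by rewrite unfold_in; case: (P u).
Qed.

Section Trees.
Variables (V : finType) (e : rel V).

Lemma sum_setT (F : V -> nat) : \sum_(v in [set: V]) F v = \sum_v F v.
Proof. by apply: eq_bigl => v; rewrite inE. Qed.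

Lemma degreeE v : degree e v = \sum_u e v u.
Proof. exact: card_set_sum. Qed.

(** If every vertex of [A] had two neighbours in [A], simple paths could be prolonged inside [A]
    until they had more than [#|V|] vertices. *)
Lemma acyclic_low_degree (A : {set V}) :
  symmetric e -> irreflexive e -> acyclic_graph e -> A != set0 ->
  exists2 x, x \in A & \sum_(y in A) e x y <= 1.
Proof.
move=> sym_e irr_e acy_e /set0Pn[a Aa]; apply/exists_inP.
apply: contraT; rewrite negb_exists_in => /forall_inP deg2.
have other x z : x \in A -> exists y, [&& y \in A, e x y & y != z].
  move=> Ax; apply/existsP; apply: contraT.
  rewrite negb_exists => /forallP no_y.
  case/negP: (deg2 x Ax); rewrite (bigID (pred1 z)) /= [X in _ + X]big1.
    rewrite addn0; case: (boolP (z \in A)) => Az.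
      rewrite (big_pred1 z) ?leq_b1 // => y /=.
      by case: eqP => [->|]; rewrite ?Az ?andbF.
    rewrite big_pred0 // => y.
    by case: eqP => [->|]; rewrite ?(negPf Az) ?andbF.
  by move=> y /andP[Ay zy]; have := no_y y; rewrite Ay zy andbT; case: (e x y).
(* A simple path in [A] can always be extended at its head, as acyclicity
   forbids the new neighbour to lie on the path. *)
have paths n : exists x p, [/\ size p = n, x \in A, path e x p & uniq (x :: p)].
  elim: n => [|n [x [p [sz_p Ax path_p uniq_p]]]]; first by exists a, [::].
  (* Avoiding the second vertex of the path makes any cycle closed by [y] have at least three
     vertices. For the one-vertex path the default [x] is harmless. *)
  have [y /and3P[Ay exy y_head]] := other x (head x p) Ax.
  have yx : y != x by apply: contraTneq exy => ->; rewrite irr_e.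
  exists y, (x :: p); split=> //=; first by rewrite sz_p.
    by rewrite sym_e exy.
  have /= -> := uniq_p; rewrite inE negb_or yx andbT /=.
  apply/negP => yp; case/splitPr: yp y_head path_p uniq_p {sz_p} => p1 p2.
  case: p1 => [|z p1] /=; first by rewrite eqxx.
  move=> _; rewrite cat_path /= => /and3P[exz path1 /andP[elast _]] uniq_p.
  have: uniq ((x :: rcons (z :: p1) y) ++ p2) by rewrite cat_cons cat_rcons.
  rewrite cat_uniq => /andP[uniq_c _].
  have /acy_e : ucycle e (x :: rcons (z :: p1) y).
    apply/andP; split=> //.
    by rewrite /= rcons_path rcons_path last_rcons exz path1 elast sym_e exy.
  by rewrite /= size_rcons.
have [x [p [sz_p _ _ uniq_p]]] := paths #|V|.
by have := max_card (mem (x :: p)); rewrite (card_uniqP uniq_p) /= sz_p ltnn.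
Qed.

(** The double sum counts each edge inside [A] twice, so this is the usual bound [#|A| - 1] for a
    forest. Deleting a vertex with at most one neighbour in [A] lowers the sum by at most 2. *)
Lemma acyclic_edge_bound (A : {set V}) :
  symmetric e -> irreflexive e -> acyclic_graph e -> A != set0 ->
  \sum_(x in A) \sum_(y in A) e x y + 2 <= 2 * #|A|.
Proof.
move=> sym_e irr_e acy_e; have [n] := ubnP #|A|.
elim: n A => // n IHn A ltAn A0.
have [x Ax degx] := acyclic_low_degree sym_e irr_e acy_e A0.
have cardA := cardsD1 x A; rewrite Ax in cardA.
have inD1 y : (y \in A) && (y != x) = (y \in A :\ x) by rewrite !inE andbC.
have sumD1 (F : V -> nat) : \sum_(y in A) F y = F x + \sum_(y in A :\ x) F y.
  by rewrite (bigD1 x Ax) /= (eq_bigl _ _ inD1).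
have split_x : \sum_(y in A :\ x) \sum_(z in A) e y z =
    \sum_(y in A) e x y + \sum_(y in A :\ x) \sum_(z in A :\ x) e y z.
  rewrite (sumD1 (fun y => e x y : nat)) irr_e add0n -big_split /=.
  by apply: eq_bigr => y _; rewrite sumD1 sym_e.
rewrite (sumD1 (fun y => \sum_(z in A) e y z)) split_x cardA.
have [A1 | A1] := eqVneq (A :\ x) set0.
  rewrite A1 cards0 !big_set0; move: (sumD1 (fun y => e x y : nat)).
  by rewrite A1 big_set0 irr_e => ->.
have := IHn (A :\ x); rewrite -ltnS; lia.
Qed.

Hypothesis tree_e : tree e.

Lemma tree_sum_degree : 0 < #|V| -> \sum_v degree e v + 2 <= 2 * #|V|.
Proof.
case: tree_e => -[sym_e irr_e] _ acy_e V0.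
have /(acyclic_edge_bound sym_e irr_e acy_e) : [set: V] != set0.
  by rewrite -cards_eq0 cardsT -lt0n.
rewrite cardsT sum_setT /=; congr (_ + _ <= _).
by apply: eq_bigr => v _; rewrite degreeE sum_setT.
Qed.

Lemma tree_degree_gt0 v : 1 < #|V| -> 0 < degree e v.
Proof.
case: tree_e => _ conn_e _ V2.
have [u uv] : exists u, u != v.
  have: 0 < #|predC1 v| by rewrite cardC1; lia.
  by case/card_gt0P => u; exists u.
have /connectP[[|z p] /= path_p def_u] := conn_e v u.
  by rewrite def_u eqxx in uv.
by apply/card_gt0P; exists z; rewrite inE; case/andP: path_p.
Qed.

Lemma tree_sum_degree_ge (A : {set V}) : 1 < #|V| ->
  2 * #|A| <= \sum_(v in A) degree e v + #|[set v | leaf e v]|.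
Proof.
move=> V2; apply: (@leq_trans (\sum_(v in A) (degree e v + leaf e v))).
  rewrite mulnC -sum_nat_const; apply: leq_sum => v _.
  by have := tree_degree_gt0 v V2; rewrite /leaf; case: eqP => /=; lia.
rewrite big_split leq_add2l /= card_set_sum big_mkcond /=.
by apply: leq_sum => v _; case: ifP.
Qed.

(** With fewer leaves, the degrees would add up to more than [2 * #|V| - 2]. *)
Lemma tree_leaves_ge2 : 1 < #|V| -> 2 <= #|[set v | leaf e v]|.
Proof.
move=> V2; have := tree_sum_degree_ge [set: V] V2.
rewrite sum_setT (cardsT V : _ = #|V|); have := tree_sum_degree (ltnW V2); lia.
Qed.

Lemma tree_vertex_cover (X : {set V}) : 1 < #|V| ->
  (forall x y, e x y -> (x \in X) || (y \in X)) ->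
  #|V| + 1 <= 2 * #|X| + #|[set v | leaf e v]|.
Proof.
move=> V2 coverX; case: (tree_e) => -[sym_e _] _ _.
(* Every edge at a vertex outside [X] ends in [X], so the complement carries at most half of the
   total degree. *)
have deg_compl : \sum_(v in ~: X) degree e v <= \sum_(v in X) degree e v.
  have -> : \sum_(v in ~: X) degree e v = \sum_(v in ~: X) \sum_(u in X) e v u.
    apply: eq_bigr => v; rewrite inE => Xv; rewrite degreeE (bigID (mem X)) /=.
    rewrite [X in _ + X]big1 ?addn0 // => u Xu.
    by case evu: (e v u) => //; move/coverX: evu; rewrite (negPf Xv) (negPf Xu).
  rewrite exchange_big /=; apply: leq_sum => u _; rewrite degreeE.
  rewrite [leqRHS](bigID (mem (~: X))) /=; apply: leq_trans (leq_addr _ _).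
  by apply: leq_sum => v _; rewrite sym_e.
have split_sum : \sum_v degree e v =
    \sum_(v in X) degree e v + \sum_(v in ~: X) degree e v.
  rewrite (bigID (mem X)) /=; congr (_ + _).
  by apply: eq_bigl => v; rewrite inE.
have := tree_sum_degree (ltnW V2); rewrite split_sum.
have := tree_sum_degree_ge (~: X) V2; have : _ = #|V| := cardsC X; lia.
Qed.

End Trees.

(** Double counting: each vertex is a leaf of at most one tree. *)
Lemma sum_leaves_le (I V : finType) (T : I -> rel V) :
  (forall v i j, i != j -> ~ (leaf (T i) v /\ leaf (T j) v)) ->
  \sum_i #|[set v | leaf (T i) v]| <= #|V|.
Proof.
move=> no_common.
have -> : \sum_i #|[set v | leaf (T i) v]| = \sum_v #|[set i | leaf (T i) v]|.
  transitivity (\sum_i \sum_v leaf (T i) v); last rewrite exchange_big /=;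
  by apply: eq_bigr => i _; rewrite card_set_sum.
rewrite -sum1_card; apply: leq_sum => v _; apply/card_le1_eqP => i j.
rewrite !inE => li lj; apply/eqP; apply: contraT => /no_common nij.
by case: (nij v).
Qed.

(** An arbitrary index set [S] lets the induction remove the tree with the fewest leaves, which gets
    its edge last; both numerical bounds pass to subsets of [S]. *)
Lemma rainbow_matching_avoiding (I V : finType) (T : I -> rel V) (w : V)
    (S : {set I}) :
  (forall i, tree (T i)) ->
  \sum_(i in S) #|[set v | leaf (T i) v]| + 2 <= #|V| ->
  4 * #|S| + 2 <= #|V| ->
  exists f : I -> {set V},
    [/\ {in S, forall i, f i \in edges (T i)},
        {in S, forall i, w \notin f i}
      & {in S &, forall i j, i != j -> [disjoint f i & f j]}].
Proof.
move=> treeT; have [n] := ubnP #|S|; elim: n S => // n IHn S ltSn leavesS cardS.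
have [-> | [i0 Si0]] := set_0Vmem S.
  by exists (fun=> set0); split=> [i | i | i j]; rewrite inE.
pose l i := #|[set v | leaf (T i) v]|.
have {}leavesS : \sum_(i in S) l i + 2 <= #|V| := leavesS.
case: (arg_minnP l Si0) => i iS min_i; have Si : i \in S := iS.
have cardSi := cardsD1 i S; rewrite Si in cardSi.
have sumS : \sum_(j in S) l j = l i + \sum_(j in S :\ i) l j.
  rewrite (bigD1 i Si) /=; congr (_ + _).
  by apply: eq_bigl => j; rewrite !inE andbC.
have /IHn[||f [f_edge f_w f_disj]] : #|S :\ i| < n by lia.
- rewrite -[leqLHS]/(\sum_(j in S :\ i) l j + 2); lia.
- lia.
pose X := w |: \bigcup_(j in S :\ i) f j.
have cardX : #|X| <= 2 * #|S| - 1.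
  have : #|\bigcup_(j in S :\ i) f j| <= #|S :\ i| * 2.
    rewrite -sum_nat_const; elim/big_rec2: _ => [|j m U /f_edge].
      by rewrite cards0.
    case/imset2P=> x y _ _ -> leU; rewrite cardsU cards2.
    by case: (x != y); lia.
  by rewrite cardsU1; case: (w \notin _); lia.
have l_i : #|S| * l i <= \sum_(j in S) l j.
  by rewrite -sum_nat_const; apply: leq_sum => j /min_i.
have [x [y [exy Xx Xy]]] : exists x y, [/\ T i x y, x \notin X & y \notin X].
  have [|no_edge] :=
      boolP [exists x, exists y, [&& T i x y, x \notin X & y \notin X]].
    by case/existsP=> x /existsP[y /and3P[]]; exists x, y.
  have V2 : 1 < #|V| by lia.
  have /(tree_vertex_cover (treeT i) V2) :
      forall x y, T i x y -> (x \in X) || (y \in X).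
    move=> x y exy; apply: contraNT no_edge; rewrite negb_or => /andP[Xx Xy].
    by apply/existsP; exists x; apply/existsP; exists y; rewrite exy Xx.
  (* Let [s = #|S|] and [n = #|V|]. A cover [X] would force [l i >= n + 3 - 4 * s], and
     [s * l i <= n - 2] then gives [(s - 1) * n <= 4 * s ^ 2 - 3 * s - 2]. As [n >= 4 * s + 2], this
     yields [s <= 0]. *)
  rewrite -/(l i); nia.
have fresh j : j \in S -> j != i -> [disjoint [set x; y] & f j].
  move=> Sj ji; rewrite disjoints_subset; apply/subsetP => z z_xy; rewrite inE.
  have : z \notin X by case/set2P: z_xy => ->.
  apply: contra => fz; apply/setU1P; right.
  by apply/bigcupP; exists j; rewrite // !inE ji.
exists (fun j => if j == i then [set x; y] else f j).
split=> [j Sj | j Sj | j h Sj Sh].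
- case: eqP => [-> | /eqP ji]; last by apply: f_edge; rewrite !inE ji.
  by apply/imset2P; exists x y; rewrite ?inE.
- case: eqP => [_ | /eqP ji]; last by apply: f_w; rewrite !inE ji.
  rewrite !inE ![w == _]eq_sym negb_or; move: Xx Xy.
  by rewrite !inE !negb_or => /andP[-> _] /andP[-> _].
- case: (eqVneq j i) => [-> | ji]; case: (eqVneq h i) => [_ | hi] //.
  + by move=> _; apply: fresh.
  + by move=> _; rewrite disjoint_sym; apply: fresh.
  + by apply: f_disj; rewrite !inE ?ji ?hi.
Qed.

Theorem theorem3 (k : nat) (V : finType) (T : 'I_k -> rel V) (w : V) :
  5 <= k ->
  (forall i : 'I_k, tree (T i)) ->
  (forall (v : V) (i j : 'I_k), i != j -> ~ (leaf (T i) v /\ leaf (T j) v)) ->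
  4 * k - 2 <= #|V| ->
  exists e : 'I_k.-1 -> {set V},
    [/\ forall i : 'I_k.-1, e i \in edges (T (widen_ord (leq_pred k) i)),
        forall i : 'I_k.-1, w \notin e i
      & forall i j : 'I_k.-1, i != j -> [disjoint e i & e j]].
Proof.
case: k T => // k T k5 treeT no_common cardV.
have V2 : 1 < #|V| by lia.
have leaves := sum_leaves_le no_common.
have last_leaves := tree_leaves_ge2 (treeT ord_max) V2.
pose S := [set~ (ord_max : 'I_k.+1)].
have split_leaves : \sum_i #|[set v | leaf (T i) v]| =
    #|[set v | leaf (T ord_max) v]| + \sum_(i in S) #|[set v | leaf (T i) v]|.
  rewrite (bigD1 ord_max) //=; congr (_ + _).
  by apply: eq_bigl => i; rewrite !inE.
(* The two leaves of the last tree pay for the [+ 2] in the leaf bound. Since [#|S| = k] after the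
   shift of [k], the size bound is exactly [4 * k.+1 - 2 = 4 * k + 2]. *)
have [||f [f_edge f_w f_disj]] := @rainbow_matching_avoiding _ V T w S treeT.
- lia.
- by rewrite cardsC1 card_ord; lia.
pose g (i : 'I_k) : 'I_k.+1 := widen_ord (leq_pred k.+1) i.
have gS i : g i \in S by rewrite !inE -val_eqE /= neq_ltn ltn_ord.
exists (f \o g); split=> [i | i | i j ij] /=.
- exact: f_edge.
- exact: f_w.
- by apply: f_disj.
Qed.
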